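(* Let $d_0\ge2$ be an integer and $\varepsilon>0$. Then $$\lim_{|G|\to\infty,\ \deg(G)\le d_0}\ \sup_{x\in E}\ \frac{E_x[\mathcal{T}_G]}{|G|^2(\log|G|)^{4+\varepsilon}}=0,$$ where the limit is over finite connected graphs $G$ with $|G|\ge2$ and $\deg(G)\le d_0$, uniformly as $|G|\to\infty$, and $E=G\times\mathbb{Z}$.
   Context: $G$ denotes a finite connected (simple, undirected) graph, identified with its vertex set; $|G|$ is its number of vertices and $\deg(G)$ the maximal number of neighbors of a vertex. The discrete cylinder $E=G\times\mathbb{Z}$ carries the product graph structure: $(g,u)$ and $(g',u')$ are neighbors iff either $g=g'$ and $|u-u'|=1$, or $u=u'$ and $g,g'$ are neighbors in $G$. For $x\in E$, $P_x$ is the law (and $E_x[\cdot]$ the expectation) of the discrete-time simple random walk $(X_n)_{n\ge0}$ on $E$ starting at $x$ (at each step it jumps to a uniformly chosen neighbor). A finite set $S\subseteq E$ disconnects $E$ if for large $M$ the sets $G\times[M,\infty)$ and $G\times(-\infty,-M]$ are contained in two distinct connected components of $E\setminus S$. The disconnection time is $\mathcal{T}_G=\inf\{n\ge0: X_{[0,n]}\text{ disconnects }E\}$, where $X_{[0,n]}=\{X_0,\dots,X_n\}$. *)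

(* Defs.v *)
From HB Require Import structures.
From mathcomp Require Export all_boot all_order all_algebra.
From mathcomp Require Export finmap.
From mathcomp Require Export all_classical all_reals all_analysis.
From mathcomp Require Import zify.
Set Implicit Arguments.
Unset Strict Implicit.
Unset Printing Implicit Defensive.
Import Order.TTheory GRing.Theory Num.Theory.
Import numFieldNormedType.Exports.
Local Open Scope classical_set_scope.
Local Open Scope ring_scope.

Section Cylinder.
Variables (G : finType) (e : rel G).

Definition connected_simple_graph : Prop :=
  [/\ symmetric e, irreflexive e & forall g h : G, connect e g h].

Definition max_degree : nat := (\max_(g : G) #|[pred h | e g h]|)%N.

Definition cyl_adj (y z : G * int) : bool :=
  ((y.1 == z.1) && (`|y.2 - z.2| == 1)) || ((y.2 == z.2) && e y.1 z.1).

(* [fset_set] is the empty set on infinite sets; every neighborhood in the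
   cylinder is finite, see [finite_cyl_adj] and [cyl_degE]. *)
Definition cyl_deg (y : G * int) : nat :=
  #|` fset_set [set z | cyl_adj y z]|%fset.

Definition step_prob (R : realType) (y z : G * int) : R :=
  if cyl_adj y z then (cyl_deg y)%:R^-1 else 0.

Definition joined_off (S : set (G * int)) (y z : G * int) : Prop :=
  exists p : seq (G * int),
    [/\ path cyl_adj y p, last y p = z & forall v, v \in y :: p -> ~ S v].

Definition is_component (S C : set (G * int)) : Prop :=
  exists2 y, ~ S y & C = [set z | joined_off S y z].

Definition disconnects (S : set (G * int)) : Prop :=
  exists M0 : int, forall M : int, M0 <= M ->
    exists C1 C2 : set (G * int),
      [/\ is_component S C1, is_component S C2, C1 <> C2,
          [set z | M <= z.2] `<=` C1 & [set z | z.2 <= - M] `<=` C2].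

Definition disconnection_time (R : realType) (X : nat -> G * int) : \bar R :=
  ereal_inf [set (n%:R)%:E |
    n in [set n : nat |
      disconnects [set X k | k in [set k : nat | (k <= n)%N]]]].

(* Since G * int is countable, measurability of the fibers of [X n] is
   measurability of [X n] for the discrete sigma-algebra; the second clause
   gives the finite-dimensional distributions, which determine the law of X. *)
Definition simple_random_walk_from (R : realType) (d : measure_display)
    (Omega : measurableType d) (P : probability Omega R)
    (X : nat -> Omega -> G * int) (x : G * int) : Prop :=
  (forall n y, measurable [set w | X n w = y]) /\
  (forall (n : nat) (y : nat -> G * int),
     P [set w | forall k, (k <= n)%N -> X k w = y k] =
     ((y 0%N == x)%:R * \prod_(i < n) step_prob R (y i) (y i.+1))%:E).

Let nbrs (y : G * int) : seq (G * int) :=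
  [:: (y.1, y.2 + 1), (y.1, y.2 - 1) & [seq (h, y.2) | h <- enum (e y.1)]].

Let nbrsE (y : G * int) : [set z | cyl_adj y z] = [set` nbrs y].
Proof.
case: y => g u; apply/seteqP; split => -[h v]; rewrite /nbrs /cyl_adj /= !inE.
- case/orP => /andP[/eqP <-].
  + move=> uv; rewrite !xpair_eqE !eqxx /=.
    have [->|->] : v = u + 1 \/ v = u - 1 by lia.
      by rewrite eqxx.
    by rewrite eqxx orbT.
  + move=> gh; apply/or3P/Or33/mapP.
    by exists h; rewrite ?mem_enum.
- case/or3P => [/eqP[-> ->]|/eqP[-> ->]|/mapP[k]].
  + by rewrite eqxx; apply/orP; left; lia.
  + by rewrite eqxx; apply/orP; left; lia.
  + by rewrite mem_enum => gk [-> ->]; rewrite eqxx; apply/orP; right.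
Qed.

Lemma finite_cyl_adj (y : G * int) : finite_set [set z | cyl_adj y z].
Proof. by rewrite nbrsE; exact: finite_seq. Qed.

Lemma cyl_degE (y : G * int) : irreflexive e ->
  cyl_deg y = (#|[pred h | e y.1 h]| + 2)%N.
Proof.
move=> irr; have nbrs_uniq : uniq (nbrs y).
  rewrite /nbrs /= !inE !xpair_eqE eqxx /= negb_or map_inj_uniq; last first.
    by move=> ? ? [].
  rewrite enum_uniq andbT -andbA; apply/and3P; split; first lia.
    by apply/negP => /mapP[k _ [_]]; lia.
  by apply/negP => /mapP[k _ [_]]; lia.
have -> : cyl_deg y = size (nbrs y).
  rewrite /cyl_deg -(undup_id nbrs_uniq) -card_fseq; congr #|` _|%fset.
  apply/fsetP => z; rewrite in_fset_set; last exact: finite_cyl_adj.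
  by rewrite nbrsE in_fset; apply/idP/idP; rewrite inE.
by rewrite /nbrs /= size_map -cardE addn2.
Qed.

End Cylinder.

(* Main.v *)
(** Covering one level G x {a} of the cylinder disconnects it, and the walk covers
    the level of its starting point within n = O(|G|^2 (log |G|)^4) steps with
    probability at least 1/2, uniformly in the starting point; restarting the
    walk every n steps gives an expected disconnection time at most 2n.

    Let L be the number of visits to the level within n steps.
    - For y in the level, the expected number of visits to the level before
      hitting y is O(|G| log |G|): it is controlled by the total conductance
      O(|G|) times an effective resistance, and the latter is O(log |G|) because
      a simple path of G times Z contains a piece of the square lattice. Hence
      the probability of missing y while L >= k decays exponentially in
      k / (|G| log |G|), and a union bound over y allows
      k = O(|G| (log |G|)^2).
    - The distance to the level is a lazy reflected walk, so L >= k with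
      probability close to 1 as soon as n is a large multiple of k^2. *)

Require Import Defs.
From mathcomp Require Import all_boot all_order all_algebra.
From mathcomp Require Import all_classical all_reals all_analysis.
From mathcomp Require Import measurable_realfun.
From mathcomp Require Import ring lra zify.
Import Order.TTheory GRing.Theory Num.Theory.
Import numFieldNormedType.Exports.
Set Implicit Arguments.
Unset Strict Implicit.
Unset Printing Implicit Defensive.
Local Open Scope classical_set_scope.
Local Open Scope ring_scope.

(** * Resistance of a wedge in the plane *)

Section Wedge.
Variable R : realFieldType.
Implicit Types (t : R) (x : nat -> nat -> R).

(** Here [a] is a gradient and [b] the flow along the same edge. Summed over edges, this bounds a
    potential difference by Dirichlet energy and flow energy separately, with [t] free to balance
    the two. *)
Lemma mul_le_flow_energy t (a b : R) : 0 < t ->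
  a * b <= a ^+ 2 / (4 * t) + t * b ^+ 2.
Proof.
move=> t0; rewrite -subr_ge0.
have -> : a ^+ 2 / (4 * t) + t * b ^+ 2 - a * b = (a - 2 * t * b) ^+ 2 / (4 * t).
  by field; rewrite gt_eqF.
by rewrite divr_ge0 ?sqr_ge0// mulr_ge0// ltW.
Qed.

Definition row_mean x i : R := (\sum_(j < i.+1) x j i) / i.+1%:R.

Lemma sum_weighted_diff (y : nat -> R) m :
  \sum_(j < m) (y j - y j.+1) * j.+1%:R = \sum_(j < m) y j - m%:R * y m.
Proof.
elim: m => [|m IH]; first by rewrite !big_ord0 mul0r subr0.
by rewrite !big_ord_recr /= IH -[m.+1%:R]natr1; ring.
Qed.

(** The coefficients form a unit flow: mass 1/(i+1) per column rises one level, then drifts right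
    until i+2 columns carry 1/(i+2) each. The excess of columns 0 to [j] is what crosses the edge
    from [j] to [j+1]. *)
Lemma row_mean_diff x i : row_mean x i - row_mean x i.+1 =
  \sum_(j < i.+1) ((x j i - x j i.+1) * i.+1%:R^-1 +
    (x j i.+1 - x j.+1 i.+1) * (j.+1%:R / (i.+1%:R * i.+2%:R))).
Proof.
rewrite big_split /= -mulr_suml sumrB.
under [X in _ = _ + X]eq_bigr do rewrite mulrA.
rewrite -mulr_suml (sum_weighted_diff (fun j => x j i.+1)) /row_mean.
rewrite (big_ord_recr i.+1) /=.
have : 0 <= i%:R :> R by [].
rewrite -![_.+2%:R]natr1 -![_.+1%:R]natr1; move: (i%:R) => u u0.
by field; apply/andP; split; rewrite gt_eqF//; lra.
Qed.

(** Each of the 2(i+1) edges of this layer carries at most 1/(i+1), so the flow energy is at most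
    2/(i+1). *)
Lemma row_mean_step x t i : 0 < t -> row_mean x i - row_mean x i.+1 <=
  (\sum_(j < i.+1) (x j i - x j i.+1) ^+ 2 +
   \sum_(j < i.+1) (x j i.+1 - x j.+1 i.+1) ^+ 2) / (4 * t) +
  2 * t * i.+1%:R^-1.
Proof.
move=> t0; rewrite row_mean_diff.
have i0 : 0 < i.+1%:R :> R by rewrite ltr0n.
have -> : 2 * t * i.+1%:R^-1 = \sum_(j < i.+1) (2 * t * i.+1%:R^-1 ^+ 2).
  rewrite sumr_const card_ord -[RHS]mulr_natr; move: (i.+1%:R) i0 => u u0.
  by field; rewrite gt_eqF.
rewrite -big_split /= mulr_suml -big_split /=; apply: ler_sum => j _.
move: (x j i - _) (_ - x j.+1 _) => a b.
have := mul_le_flow_energy a i.+1%:R^-1 t0.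
have := mul_le_flow_energy b (j.+1%:R / (i.+1%:R * i.+2%:R)) t0.
have : (j.+1%:R / (i.+1%:R * i.+2%:R)) ^+ 2 <= i.+1%:R^-1 ^+ 2 :> R.
  rewrite ler_sqr ?nnegrE ?divr_ge0 ?mulr_ge0 ?invr_ge0//.
  rewrite invfM mulrCA ler_piMr ?invr_ge0// ler_pdivrMr ?ltr0n//.
  by rewrite mul1r ler_nat ltnW// ltnS ltn_ord.
move=> /(ler_wpM2l (ltW t0)).
rewrite (mulrDl (a ^+ 2)) -[2 * t * _]mulrA.
move: (a ^+ 2 / _) (b ^+ 2 / _) (t * _) (t * _) (a * _) (b * _) => ? ? ? ? ? ?.
lra.
Qed.

(* A unit flow from (0,0) that is uniform on the columns 0..i at height i
   has energy at most twice the harmonic sum, as in the plane. *)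
Lemma wedge_bound x t L : 0 < t -> x 0%N 0%N - row_mean x L <=
  (\sum_(i < L) \sum_(j < i.+1) (x j i - x j i.+1) ^+ 2 +
   \sum_(i < L) \sum_(j < i.+1) (x j i.+1 - x j.+1 i.+1) ^+ 2) / (4 * t) +
  2 * t * \sum_(i < L) i.+1%:R^-1.
Proof.
move=> t0.
have -> : x 0%N 0%N - row_mean x L =
    \sum_(i < L) (row_mean x i - row_mean x i.+1).
  elim: L => [|L IH]; first by rewrite big_ord0 /row_mean big_ord1 divr1 subrr.
  by rewrite big_ord_recr /= -IH; ring.
rewrite mulr_sumr -big_split mulr_suml -big_split /=.
by apply: ler_sum => i _; exact: row_mean_step.
Qed.

End Wedge.

(** * Dirichlet energy on the half cylinder *)

Section Energy.
Variables (R : realFieldType) (G : finType) (e : rel G).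
Implicit Types (v : G -> nat -> R) (p : nat -> G).

(* Level 0 is a mirror: its vertical edge counts twice, since the half cylinder
   stands for a function on the cylinder that is even in the height. *)
Definition half_laplacian v g i : R :=
  \sum_(h | e g h) (v g i - v h i) +
  (if i is j.+1 then (v g i - v g i.+1) + (v g i - v g j)
   else 2 * (v g 0%N - v g 1%N)).

Definition ver_energy v i : R := \sum_g (v g i - v g i.+1) ^+ 2.

(* Every horizontal edge occurs twice in the double sum. *)
Definition hor_energy v i : R :=
  (\sum_g \sum_(h | e g h) (v g i - v h i) ^+ 2) / 2.

(** Horizontal edges of level 0 are left out: the wedges use none of them. *)
Definition energy v n : R :=
  \sum_(i < n) ver_energy v i + \sum_(i < n) hor_energy v i.+1.

Lemma hor_energyE v i : symmetric e ->
  hor_energy v i = \sum_g \sum_(h | e g h) v g i * (v g i - v h i).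
Proof.
move=> syme; pose S := \sum_g \sum_(h | e g h) v g i * (v g i - v h i).
have eS : S = \sum_g \sum_(h | e g h) v h i * (v h i - v g i).
  rewrite /S (exchange_big_dep xpredT)//=; apply: eq_bigr => g _.
  by apply: eq_bigl => h; rewrite syme.
have : S + S = \sum_g \sum_(h | e g h) (v g i - v h i) ^+ 2.
  rewrite {2}eS -big_split /=; apply: eq_bigr => g _.
  by rewrite -big_split /=; apply: eq_bigr => h _; ring.
by rewrite /hor_energy => <-; rewrite -/S; field.
Qed.

(** Summation by parts. Level 0 has weight 1/2 because its Laplacian counts the mirrored edge twice;
    the inequality discards the horizontal energy of level 0 and [ver_energy v n]. *)
Lemma green v n : symmetric e -> (forall g, v g n.+1 = 0) ->
  energy v n <= (\sum_g v g 0%N * half_laplacian v g 0) / 2 +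
    \sum_(i < n) \sum_g v g i.+1 * half_laplacian v g i.+1.
Proof.
move=> syme v0.
pose vert g i := if i is j.+1 then (v g i - v g i.+1) + (v g i - v g j)
  else 2 * (v g 0%N - v g 1%N).
have lapE i : \sum_g v g i * half_laplacian v g i = hor_energy v i +
    \sum_g v g i * vert g i.
  rewrite (hor_energyE _ _ syme) -big_split; apply: eq_bigr => g _ /=.
  by rewrite mulrDr mulr_sumr.
have hor0 : 0 <= hor_energy v 0.
  rewrite divr_ge0// sumr_ge0// => g _; rewrite sumr_ge0// => h _.
  exact: sqr_ge0.
(* Keeping the boundary term in place of the boundary condition makes the claim inductive in [n]. *)
suff parts : energy v n + ver_energy v n <=
    (\sum_g v g 0%N * half_laplacian v g 0) / 2 +
    \sum_(i < n) \sum_g v g i.+1 * half_laplacian v g i.+1 +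
    \sum_g v g n.+1 * (v g n.+1 - v g n).
  move: parts; rewrite [X in _ <= _ + X -> _]big1 => [|g _];
    last by rewrite v0 mul0r.
  rewrite addr0; apply: le_trans; rewrite lerDl sumr_ge0// => g _.
  exact: sqr_ge0.
elim: n {v0} => [|n IH].
  rewrite /energy !big_ord0 !addr0 add0r lapE mulrDl -[leLHS]add0r -addrA.
  apply: lerD; first by rewrite divr_ge0.
  rewrite mulr_suml -big_split /= le_eqVlt; apply/orP; left; apply/eqP.
  by apply: eq_bigr => g _; rewrite /vert; field.
have -> : energy v n.+1 = energy v n + ver_energy v n + hor_energy v n.+1.
  by rewrite /energy !big_ord_recr /=; ring.
rewrite [\sum_(i < n.+1) _]big_ord_recr /= (lapE n.+1).
have -> : ver_energy v n.+1 = \sum_g v g n.+1 * vert g n.+1 +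
    \sum_g v g n.+2 * (v g n.+2 - v g n.+1) -
    \sum_g v g n.+1 * (v g n.+1 - v g n).
  rewrite -big_split -sumrB /=; apply: eq_bigr => g _; rewrite /vert; ring.
move: IH; lra.
Qed.

Lemma sum_injective_le (f : G -> R) p m : (forall g, 0 <= f g) ->
  {in gtn m &, injective p} -> \sum_(j < m) f (p j) <= \sum_g f g.
Proof.
move=> f0 injp.
have us : uniq [seq p j | j <- iota 0 m].
  rewrite map_inj_in_uniq ?iota_uniq// => i j.
  by rewrite !mem_iota !add0n /=; exact: injp.
rewrite -(big_mkord xpredT (f \o p)) -(big_map p xpredT f) /index_iota subn0.
rewrite (big_uniq _ us) /= big_mkcond /=.
by apply: ler_sum => g _; case: ifP.
Qed.

(** The simple path [p] embeds the planar wedge in the half cylinder. The divisor is [2 * t] and not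
    [4 * t] because [hor_energy] halves a double sum in which only one direction of each path edge
    is used. *)
Lemma path_wedge_bound v p t L n : 0 < t -> (L <= n)%N ->
  {in gtn L.+1 &, injective p} -> (forall j, (j < L)%N -> e (p j) (p j.+1)) ->
  `|v (p 0%N) 0%N - row_mean (fun j => v (p j)) L| <=
    energy v n / (2 * t) + 2 * t * \sum_(i < L) i.+1%:R^-1.
Proof.
move=> t0 Ln injp adj.
(* Applied to [v] and to its opposite, which have the same energies, this yields the absolute
   value. *)
suff key w : (forall i, ver_energy w i = ver_energy v i) ->
    (forall i, hor_energy w i = hor_energy v i) ->
    w (p 0%N) 0%N - row_mean (fun j => w (p j)) L <=
    energy v n / (2 * t) + 2 * t * \sum_(i < L) i.+1%:R^-1.
  rewrite ler_norml key// andbT lerNl.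
  have := key (fun g i => - v g i).
  rewrite /row_mean sumrN mulNr opprB opprK addrC; apply => i.
    by apply: eq_bigr => g _; ring.
  congr (_ / _); apply: eq_bigr => g _; apply: eq_bigr => h _; ring.
move=> verE horE.
apply: le_trans (wedge_bound (fun j => w (p j)) L t0) _; rewrite lerD2r.
have inj i : (i < L)%N -> {in gtn i.+1 &, injective p}.
  move=> iL a b; rewrite !inE => ai bi.
  by apply: injp; rewrite inE; lia.
have ver_ge0 i : 0 <= ver_energy v i.
  by rewrite sumr_ge0// => g _; exact: sqr_ge0.
have hor_ge0 i : 0 <= hor_energy v i.
  rewrite divr_ge0// sumr_ge0// => g _; rewrite sumr_ge0// => h _.
  exact: sqr_ge0.
have widen (f : nat -> R) : (forall i, 0 <= f i) ->
    \sum_(i < L) f i <= \sum_(i < n) f i.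
  move=> f0; rewrite (big_ord_widen n f Ln) big_mkcond /=.
  by apply: ler_sum => i _; case: ifP.
have ver_le : \sum_(i < L) \sum_(j < i.+1) (w (p j) i - w (p j) i.+1) ^+ 2 <=
    \sum_(i < n) ver_energy v i.
  apply: le_trans (widen _ ver_ge0); apply: ler_sum => i _; rewrite -verE.
  apply: (sum_injective_le (f := fun g => (w g i - w g i.+1) ^+ 2)).
    by move=> g; exact: sqr_ge0.
  exact: inj.
have hor_le :
    \sum_(i < L) \sum_(j < i.+1) (w (p j) i.+1 - w (p j.+1) i.+1) ^+ 2 <=
    2 * \sum_(i < n) hor_energy v i.+1.
  apply: (@le_trans _ _ (2 * \sum_(i < L) hor_energy v i.+1)); last first.
    by rewrite ler_pM2l// (widen (fun i => hor_energy v i.+1)).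
  rewrite mulr_sumr; apply: ler_sum => i _; rewrite -horE /hor_energy.
  rewrite mulrC divfK//.
  pose f g := \sum_(h | e g h) (w g i.+1 - w h i.+1) ^+ 2.
  apply: (@le_trans _ _ (\sum_(j < i.+1) f (p j))); last first.
    apply: sum_injective_le; last exact: inj.
    by move=> g; rewrite sumr_ge0// => h _; exact: sqr_ge0.
  apply: ler_sum => j _; rewrite /f (bigD1 (p j.+1)) /=; last first.
    by apply: adj; have := ltn_ord j; have := ltn_ord i; lia.
  by rewrite lerDl sumr_ge0// => h _; exact: sqr_ge0.
have -> : energy v n / (2 * t) = 2 * energy v n / (4 * t).
  by field; rewrite gt_eqF.
rewrite ler_pM2r ?invr_gt0 ?mulr_gt0// /energy.
move: ver_le hor_le (widen _ ver_ge0) => A B C.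
have D : 0 <= \sum_(i < n) ver_energy v i by rewrite sumr_ge0.
by apply: le_trans (lerD A B) _; rewrite mulrDr lerD2r; lra.
Qed.

(* The two wedges issued from the ends of a simple path have the same top row,
   so their flows concatenate to a unit flow from w to y. *)
Lemma oscillation_bound v t n (w y : G) : 0 < t -> symmetric e ->
  connect e w y -> (#|G| <= n)%N ->
  v w 0%N - v y 0%N <= energy v n / t + 4 * t * \sum_(i < #|G|) i.+1%:R^-1.
Proof.
move=> t0 syme /connectP[s0 es0 ->]; case/shortenP: es0 => s es us _ Gn {y}.
(* [q] is [p] read backwards; it carries the wedge issued from the other end. *)
pose L := size s; pose p j := nth w (w :: s) j; pose q j := p (L - j)%N.
have sG : (L < #|G|)%N.
  by rewrite -[L.+1]/(size (w :: s)) -(card_uniqP us) max_card.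
have injp : {in gtn L.+1 &, injective p}.
  by move=> i j; rewrite !inE => iL jL /eqP; rewrite nth_uniq// => /eqP.
have adj j : (j < L)%N -> e (p j) (p j.+1) by move=> jL; exact: (pathP w es).
have injq : {in gtn L.+1 &, injective q}.
  move=> i j; rewrite !inE => iL jL /injp; rewrite !inE => H.
  by have := H ltac:(lia) ltac:(lia); lia.
have adjq j : (j < L)%N -> e (q j) (q j.+1).
  move=> jL; rewrite syme /q.
  by rewrite (_ : (L - j = (L - j.+1).+1)%N); [apply: adj|]; lia.
have Ln : (L <= n)%N by lia.
have := path_wedge_bound v t0 Ln injp adj.
have := path_wedge_bound v t0 Ln injq adjq.
have -> : row_mean (fun j => v (q j)) L = row_mean (fun j => v (p j)) L.
  congr (_ / _); rewrite [RHS](reindex_inj rev_ord_inj) /=.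
  by apply: eq_bigr => j _; rewrite /q; congr (v (p _) _); rewrite subSS.
have -> : q 0%N = last w s by rewrite /q subn0 /p /L (last_nth w).
rewrite -[p 0%N]/w.
have H : \sum_(i < L) i.+1%:R^-1 <= \sum_(i < #|G|) i.+1%:R^-1 :> R.
  rewrite (big_ord_widen #|G| (fun i => i.+1%:R^-1) (ltnW sG)) big_mkcond /=.
  by apply: ler_sum => i _; case: ifP => // _; rewrite invr_ge0.
move: H => /(ler_wpM2l (ltW t0)).
rewrite !ler_norml => H /andP[A _] /andP[_ B].
have -> : energy v n / t = 2 * (energy v n / (2 * t)).
  by field; rewrite gt_eqF.
move: H A B; rewrite -!mulrA.
move: (energy v n / _) (_ * _) (_ * _) => E a b; lra.
Qed.

End Energy.

(** * Expectations along the walk *)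

Section Walk.
Variables (R : realFieldType) (G : finType) (e : rel G).
Implicit Types (f : G * int -> R) (v : G -> nat -> R) (x z : G * int)
  (F : seq (G * int) -> R) (q : seq (G * int)).

Definition cyl_valency g : R := (#|[pred h | e g h]| + 2)%:R.

Lemma cyl_valency_gt0 g : 0 < cyl_valency g.
Proof. by rewrite ltr0n addn2. Qed.
Hint Resolve cyl_valency_gt0 : core.

Lemma cyl_valencyE g : cyl_valency g = \sum_(h | e g h) 1 + 2.
Proof. by rewrite /cyl_valency natrD sumr_const. Qed.

Definition walk_avg f x : R :=
  (\sum_(h | e x.1 h) f (h, x.2) +
    (f (x.1, x.2 + 1) + f (x.1, x.2 - 1))) / cyl_valency x.1.

Lemma walk_avg_le f1 f2 x : (forall z, f1 z <= f2 z) ->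
  walk_avg f1 x <= walk_avg f2 x.
Proof.
move=> f12; rewrite ler_wpM2r ?invr_ge0 ?(ltW (cyl_valency_gt0 _))//.
by rewrite !lerD// ler_sum.
Qed.

Lemma walk_avgD f1 f2 x :
  walk_avg (fun z => f1 z + f2 z) x = walk_avg f1 x + walk_avg f2 x.
Proof. by rewrite /walk_avg big_split /= -mulrDl; congr (_ / _); ring. Qed.

Lemma walk_avgZ c f x : walk_avg (fun z => c * f z) x = c * walk_avg f x.
Proof. by rewrite /walk_avg -mulr_sumr mulrA; congr (_ / _); ring. Qed.

Lemma walk_avg_cst c x : walk_avg (fun=> c) x = c.
Proof.
rewrite /walk_avg; have -> : \sum_(h | e x.1 h) c = c * \sum_(h | e x.1 h) 1.
  by rewrite mulr_sumr mulr1.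
have := cyl_valency_gt0 x.1; rewrite cyl_valencyE => /gt_eqF n0.
have -> (s : R) : c * s + (c + c) = c * (s + 2) by ring.
by rewrite mulfK ?n0.
Qed.

(* [walk_exp n x F] is the expectation of [F [:: X_0; ..; X_(n-1)]]
   for the simple random walk X started at x. *)
Fixpoint walk_exp n x F : R :=
  if n is m.+1 then walk_avg (fun z => walk_exp m z (fun q => F (x :: q))) x
  else F [::].

Lemma walk_exp_le n x F1 F2 : (forall q, size q = n -> F1 q <= F2 q) ->
  walk_exp n x F1 <= walk_exp n x F2.
Proof.
elim: n x F1 F2 => [|n IH] x F1 F2 F12 /=; first exact: F12.
by apply: walk_avg_le => z; apply: IH => q sq; apply: F12; rewrite /= sq.
Qed.

Lemma walk_expD n x F1 F2 : walk_exp n x (fun q => F1 q + F2 q) =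
  walk_exp n x F1 + walk_exp n x F2.
Proof.
elim: n x F1 F2 => [|n IH] x F1 F2 //=; rewrite -walk_avgD.
by congr walk_avg; apply/funext => z; rewrite IH.
Qed.

Lemma walk_expZ n x c F : walk_exp n x (fun q => c * F q) = c * walk_exp n x F.
Proof.
elim: n x F => [|n IH] x F //=; rewrite -walk_avgZ.
by congr walk_avg; apply/funext => z; rewrite IH.
Qed.

Lemma walk_exp_cst n x c : walk_exp n x (fun=> c) = c.
Proof.
elim: n x => [|n IH] x //=; rewrite -[RHS](walk_avg_cst _ x).
by congr walk_avg; apply/funext => z; rewrite IH.
Qed.

Lemma walk_exp_sum (I : Type) (r : seq I) n x (F : I -> seq (G * int) -> R) :
  walk_exp n x (fun q => \sum_(i <- r) F i q) =
  \sum_(i <- r) walk_exp n x (F i).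
Proof.
elim: r => [|i r IH].
  rewrite big_nil -[RHS](walk_exp_cst n x).
  by congr walk_exp; apply/funext => q; rewrite big_nil.
rewrite big_cons -IH -walk_expD.
by congr walk_exp; apply/funext => q; rewrite big_cons.
Qed.

(** Markov property at time [n]: the last [m] positions form a fresh walk, whose expectation is at
    most [c] from any starting point. *)
Lemma walk_exp_markov n m x c F F1 F2 :
  (forall q1 q2, F (q1 ++ q2) <= F1 q1 * F2 q2) -> (forall q, 0 <= F1 q) ->
  (forall z, walk_exp m z F2 <= c) ->
  walk_exp (n + m) x F <= c * walk_exp n x F1.
Proof.
elim: n x F F1 => [|n IH] x F F1 FF F1_ge0 F2c /=.
  apply: le_trans (walk_exp_le (F2 := fun q => F1 [::] * F2 q) _ _) _ => [q _|].
    exact: (FF [::]).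
  by rewrite walk_expZ mulrC ler_wpM2r.
rewrite -walk_avgZ; apply: walk_avg_le => z.
by apply: IH => // q1 q2; apply: (FF (x :: q1)).
Qed.

Definition half_avg v g i : R :=
  (\sum_(h | e g h) v h i +
    (if i is j.+1 then v g i.+1 + v g j else 2 * v g 1%N)) / cyl_valency g.

Lemma half_avg_le v1 v2 g i : (forall g i, v1 g i <= v2 g i) ->
  half_avg v1 g i <= half_avg v2 g i.
Proof.
move=> v12; rewrite ler_wpM2r ?invr_ge0 ?(ltW (cyl_valency_gt0 _))//.
rewrite lerD ?ler_sum//.
by case: i => [|i]; rewrite ?ler_wpM2l ?lerD.
Qed.

Lemma half_avg_cst c g i : half_avg (fun _ _ => c) g i = c.
Proof.
rewrite -[RHS](walk_avg_cst c (g, i%:Z)) /half_avg /walk_avg /=.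
by congr ((_ + _) / _); case: i => //; ring.
Qed.

Lemma half_laplacianE v g i :
  half_laplacian e v g i = cyl_valency g * (v g i - half_avg v g i).
Proof.
rewrite mulrBr [X in _ - X]mulrC divfK ?lt0r_neq0// /half_laplacian sumrB.
rewrite cyl_valencyE.
have -> : \sum_(h | e g h) v g i = (\sum_(h | e g h) 1) * v g i.
  by rewrite mulr_suml mul1r.
by case: i => [|i]; ring.
Qed.

Definition level_dist (a u : int) : nat := absz (u - a)%R.

Lemma level_distxx a : level_dist a a = 0%N.
Proof. by rewrite /level_dist subrr. Qed.

Lemma level_dist_eq0 a u : (level_dist a u == 0%N) = (u == a).
Proof. by rewrite absz_eq0 subr_eq0. Qed.

(* The distance to level a turns the walk on the cylinder into a walk on the
   half cylinder reflected at 0. *)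
Lemma walk_avg_fold v a x :
  walk_avg (fun z => v z.1 (level_dist a z.2)) x = half_avg v x.1 (level_dist a x.2).
Proof.
case: x => g u /=; rewrite /walk_avg /half_avg /=; congr ((_ + _) / _).
rewrite /level_dist; have [->|] := eqVneq u a.
  have -> : absz (a - a)%R = 0%N by lia.
  have -> : absz (a + 1 - a)%R = 1%N by lia.
  by have -> : absz (a - 1 - a)%R = 1%N; [lia | ring].
move=> ua; have [ua'|ua'] := leP u a.
  have -> : absz (u - a)%R = (absz (u + 1 - a)%R).+1 by lia.
  have -> : absz (u - 1 - a)%R = (absz (u + 1 - a)%R).+2 by lia.
  by rewrite addrC.
have -> : absz (u - a)%R = (absz (u - 1 - a)%R).+1 by lia.
by have -> : absz (u + 1 - a)%R = (absz (u - 1 - a)%R).+2 by lia.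
Qed.

(* Expected number of visits to level 0 by the folded walk during n steps,
   before it hits (y, 0). *)
Fixpoint killed_visits y n g i : R :=
  if n is m.+1 then
    if (g == y) && (i == 0%N) then 0
    else (i == 0%N)%:R + half_avg (killed_visits y m) g i
  else 0.

Lemma killed_visits_ge0 y n g i : 0 <= killed_visits y n g i.
Proof.
elim: n g i => [|n IH] g i //=; case: ifP => // _; rewrite addr_ge0//.
by rewrite -(half_avg_cst 0 g i) half_avg_le.
Qed.

(** Together with the recursion this gives, at a fixed horizon, [v <= 1 + half_avg v] on level 0 and
    [v <= half_avg v] above it, hence an upper bound on the Laplacian. *)
Lemma killed_visits_leS y n g i :
  killed_visits y n g i <= killed_visits y n.+1 g i.
Proof.
elim: n g i => [|n IH] g i; first exact: killed_visits_ge0.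
rewrite [leLHS]/= [leRHS]/=; case: ifP => // _.
by rewrite lerD2l half_avg_le.
Qed.

(** Reaching level 0 from level [i] takes [i] steps. This provides the vanishing at the top that
    [green] requires. *)
Lemma killed_visits_far y n g i : (n <= i)%N -> killed_visits y n g i = 0.
Proof.
elim: n g i => [|n IH] g [|i]//; rewrite ltnS => ni /=.
rewrite andbF add0r /half_avg big1 => [|h _]; last by rewrite IH// ltnW.
by rewrite !IH ?addr0 ?mul0r//; lia.
Qed.

Definition visits_bound (d : nat) : R :=
  8 * (d + 2)%:R * #|G|%:R * \sum_(i < #|G|) i.+1%:R^-1.

Lemma killed_visits_bound d y n g i : symmetric e ->
  (forall g h, connect e g h) -> (max_degree e <= d)%N ->
  killed_visits y n g i <= visits_bound d.
Proof.
move=> syme conn maxd.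
have G0 : (0 < #|G|)%N by apply/card_gt0P; exists y.
have val_le h : cyl_valency h <= (d + 2)%:R.
  rewrite ler_nat leq_add2r (leq_trans _ maxd)//.
  exact: (@leq_bigmax _ (fun h => #|[pred k | e h k]|) h).
(* If c is the maximum of the visit counts on level 0, their energy is at most
   B c, and the oscillation bound with t = 2 B reads
   c <= c / 2 + O(B log |G|). *)
have level0 m h : killed_visits y m h 0 <= visits_bound d.
  pose v := killed_visits y m.
  have [w _ vmax] := @arg_maxP _ R _ y xpredT (fun h => v h 0%N) isT.
  have wmax k : v k 0%N <= v w 0%N by exact: vmax.
  apply: le_trans (wmax h) _ => {h vmax}.
  (* [M] is high enough both for [v] to vanish above it and for the wedges to fit below it. The half
     in [B] is the weight of level 0 in [green]. *)
  pose M := (m + #|G|)%N; pose B : R := (d + 2)%:R * #|G|%:R / 2.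
  have B0 : 0 < B by rewrite divr_gt0// mulr_gt0 ?ltr0n// addn2.
  have lap h j : v h j * half_laplacian e v h j <= v h j * cyl_valency h * (j == 0%N)%:R.
    rewrite half_laplacianE -mulrA; have := killed_visits_leS y m h j.
    rewrite -/v /=; case: ifP => [/andP[/eqP-> /eqP->] _|_ vle].
      have -> : v y 0%N = 0 by rewrite /v; case: (m) => //= ?; rewrite !eqxx.
      by rewrite !mul0r.
    rewrite ler_wpM2l ?killed_visits_ge0// ler_wpM2l ?(ltW (cyl_valency_gt0 _))//.
    by rewrite lerBlDr.
  have EB : energy e v M <= B * v w 0%N.
    apply: le_trans (green syme _) _ => [h|].
      by rewrite /v killed_visits_far// /M; lia.
    rewrite -[leRHS]addr0 lerD//; last first.
      rewrite sumr_le0// => j _; rewrite sumr_le0// => h _.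
      by apply: le_trans (lap _ _) _; rewrite mulr0.
    rewrite /B mulrAC ler_pM2r ?invr_gt0//.
    have -> : (d + 2)%:R * #|G|%:R * v w 0%N = \sum_(h : G) (v w 0%N * (d + 2)%:R).
      by rewrite sumr_const -[RHS]mulr_natr; ring.
    apply: ler_sum => h _; apply: le_trans (lap _ _) _; rewrite mulr1.
    by rewrite ler_pM ?killed_visits_ge0 ?(ltW (cyl_valency_gt0 _))// wmax.
  have B20 : 0 < 2 * B by rewrite mulr_gt0.
  have GM : (#|G| <= M)%N by rewrite leq_addl.
  have := oscillation_bound v B20 syme (conn w y) GM.
  have -> : v y 0%N = 0 by rewrite /v; case: (m) => //= ?; rewrite !eqxx.
  have : energy e v M / (2 * B) <= v w 0%N / 2.
    rewrite ler_pdivrMr//; apply: le_trans EB _.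
    by rewrite le_eqVlt; apply/orP; left; apply/eqP; field.
  have -> : 4 * (2 * B) * \sum_(i < #|G|) i.+1%:R^-1 = visits_bound d / 2.
    by rewrite /B /visits_bound; field.
  by rewrite -/v; lra.
(* Off level 0 no visit is counted, so the value is an average of values with a shorter horizon. *)
elim: n g i => [|n IH] g [|i]; try exact: level0.
  exact: le_trans (level0 0%N y).
rewrite /= andbF add0r -(half_avg_cst (visits_bound d) g i.+1).
by rewrite half_avg_le.
Qed.

End Walk.

(** * Probability of covering a level *)

Section Cover.
Variables (R : realFieldType) (G : finType) (e : rel G).
Implicit Types (x : G * int) (q : seq (G * int)).

Definition level_visits (a : int) q := count (fun z => z.2 == a) q.

(* The factor (1 + killed_visits / A) takes values in [1, 2] and decreases in
   mean by at least 1 / A at each visit to the level, hence by a factor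
   at most 1 - 1 / (2 A). *)
Lemma unhit_tail (A : R) y a k n x : 1 <= A ->
  (forall n g i, killed_visits R e y n g i <= A) ->
  walk_exp e n x
    (fun q => (((y, a) \notin q) && (k <= level_visits a q)%N)%:R) <=
  (1 + killed_visits R e y n x.1 (level_dist a x.2) / A) *
    (1 - (2 * A)^-1) ^+ k.
Proof.
move=> A1 kvA; have A0 : 0 < A by lra.
pose c : R := A^-1; have c0 : 0 < c by rewrite invr_gt0.
have c1 : c <= 1 by rewrite invf_le1.
have -> : (2 * A)^-1 = c / 2 by rewrite /c; field; rewrite gt_eqF.
rewrite -/c; pose b := 1 - c / 2; rewrite -/b.
have b0 : 0 <= b by rewrite /b; lra.
have b1 : b <= 1 by rewrite /b; lra.
have kc0 m g i : 0 <= killed_visits R e y m g i * c.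
  by rewrite mulr_ge0 ?killed_visits_ge0// ltW.
have kc1 m g i : killed_visits R e y m g i * c <= 1.
  by rewrite ler_pdivrMr ?mul1r.
elim: n x k => [|n IH] x k.
  rewrite [leLHS]/= /= mul0r addr0 mul1r.
  by case: k => [|k]; rewrite ?expr0//= exprn_ge0.
have [->|xy] := eqVneq x (y, a).
  apply: (@le_trans _ _ 0); last by rewrite mulr_ge0 ?exprn_ge0// addr_ge0.
  rewrite -[leRHS](walk_exp_cst e n.+1 (y, a)) /=.
  apply: walk_avg_le => z; apply: walk_exp_le => q _.
  by rewrite in_cons eqxx.
pose j := (k - (x.2 == a))%N.
have step : walk_exp e n.+1 x
    (fun q => (((y, a) \notin q) && (k <= level_visits a q)%N)%:R) <=
    b ^+ j * (1 + c * half_avg e (killed_visits R e y n) x.1 (level_dist a x.2)).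
  rewrite -walk_avg_fold -walk_avgZ.
  rewrite -[X in _ * (X + _)](walk_avg_cst e 1 x) -walk_avgD -walk_avgZ /=.
  apply: walk_avg_le => z.
  rewrite mulrC [c * _]mulrC; apply: le_trans (IH z j).
  apply: walk_exp_le => q _; rewrite in_cons eq_sym (negbTE xy) /=.
  by rewrite /j leq_subLR.
apply: le_trans step _.
have := kc1 n.+1 x.1 (level_dist a x.2); have := kc0 n.+1 x.1 (level_dist a x.2).
have -> : killed_visits R e y n.+1 x.1 (level_dist a x.2) =
    (x.2 == a)%:R + half_avg e (killed_visits R e y n) x.1 (level_dist a x.2).
  rewrite /= level_dist_eq0.
  by rewrite -xpair_eqE -surjective_pairing (negbTE xy).
move: (half_avg _ _ _ _) => h; rewrite /j.
case: eqP => [xa|_]; last by rewrite subn0 add0r => _ _; rewrite mulrC [c * _]mulrC.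
rewrite -[true%:R]/1; case: k j => [|k] j H0 H1.
  by rewrite sub0n !expr0 mulr1 mul1r; lra.
rewrite subn1 exprS -[k.+1.-1]/k; move: (b ^+ k) (exprn_ge0 k b0) => B B0.
rewrite [leRHS]mulrA [leRHS]mulrC ler_wpM2l//.
(* With [u = 1 + (1 + h) * c], which is at most 2, the mean after the visit is [u - c], hence at
   most [u * (1 - c / 2)]. *)
have : 0 <= c * (1 - (1 + h) * c) by rewrite mulr_ge0 ?(ltW c0)// subr_ge0.
rewrite /b; lra.
Qed.

(* rho ^ (distance to the level + visits still needed), discounted by 1 + s per
   step, is a submartingale. *)
Lemma local_time_lower (rho s : R) a k n x :
  0 < rho <= 1 -> 0 <= s -> s <= (1 - rho) / 3 ->
  (forall g, s * cyl_valency R e g <= (1 - rho) ^+ 2) ->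
  (forall g, 3 <= cyl_valency R e g) ->
  rho ^+ (level_dist a x.2 + k) <=
  walk_exp e n x (fun q => (k <= level_visits a q)%N%:R) + (1 + s) ^- n.
Proof.
move=> /andP[rho0 rho1] s0 s3 sval val3.
have s1 : 0 < 1 + s by lra.
elim: n x k => [|n IH] x k.
  rewrite expr0 invr1; apply: (@le_trans _ _ 1); first by rewrite exprn_ile1 ?(ltW rho0).
  by rewrite lerDr.
have P0 m z F : (forall q, 0 <= F q) -> 0 <= walk_exp e m z F :> R.
  by move=> F0; rewrite -[leLHS](walk_exp_cst e m z); exact: walk_exp_le.
case: k => [|k].
  rewrite [X in _ <= X + _](_ : _ = 1).
    apply: (@le_trans _ _ 1); first by rewrite exprn_ile1 ?(ltW rho0).
    by rewrite lerDl invr_ge0 exprn_ge0 ?(ltW s1).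
  exact: walk_exp_cst.
pose j := (k.+1 - (x.2 == a))%N.
pose phi := half_avg e (fun _ i => rho ^+ i) x.1 (level_dist a x.2).
set P := walk_exp _ _ _ _.
have step : rho ^+ j * phi <= P + (1 + s) ^- n.
  rewrite /P /phi -walk_avg_fold -walk_avgZ -[(1 + s) ^- n](walk_avg_cst e _ x).
  rewrite /= -walk_avgD; apply: walk_avg_le => z.
  rewrite -exprD addnC; apply: le_trans (IH z j) _; rewrite lerD2r.
  by apply: walk_exp_le => q _; rewrite /j leq_subLR.
have P_ge0 : 0 <= P by exact: P0.
have r1 : (1 + s)^-1 <= 1 by rewrite invf_le1//; lra.
have phi_ge : rho ^+ (level_dist a x.2 + k.+1) * (1 + s) <= rho ^+ j * phi.
  rewrite /phi /j; have := val3 x.1; have := sval x.1.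
  have avgE i : half_avg e (fun _ i => rho ^+ i) x.1 i =
      ((cyl_valency R e x.1 - 2) * rho ^+ i +
       (if i is i'.+1 then rho ^+ i.+1 + rho ^+ i' else 2 * rho)) / cyl_valency R e x.1.
    rewrite /half_avg cyl_valencyE addrK mulr_suml.
    congr ((_ + _) / _); first by under [RHS]eq_bigr do rewrite mul1r.
  rewrite avgE; move: (cyl_valency R e x.1) => D sD D3.
  have D0 : 0 < D by lra.
  (* On the level the visit gains a factor 1/rho, while a vertical move costs [1 - rho] with
     probability 2/D, at most 2/3; the remaining third of [1 - rho] pays for [s]. *)
  have [xa|xa] := eqVneq x.2 a.
    rewrite xa level_distxx.
    rewrite subn1 add0n exprS expr0 mulr1 [rho * _]mulrC -mulrA.
    rewrite ler_pM2l ?exprn_gt0// ler_pdivlMr//.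
    have : 0 <= ((1 - rho) / 3 - s) * (rho * D).
      by rewrite mulr_ge0 ?mulr_ge0 ?(ltW rho0) ?(ltW D0) ?subr_ge0.
    have : 0 <= (1 - rho) * (1 - rho) * D.
      by rewrite mulr_ge0 ?mulr_ge0 ?(ltW D0) ?subr_ge0.
    have : 0 <= (1 - rho) * (D - 3) by rewrite mulr_ge0//; lra.
    nra.
  (* Off the level the gain comes from convexity: [rho + 1/rho - 2] is at least [(1 - rho) ^+ 2],
     hence at least [s * D]. *)
  have [i ->] : exists i, level_dist a x.2 = i.+1.
    by exists (level_dist a x.2).-1; rewrite prednK// lt0n level_dist_eq0.
  rewrite subn0 addnC exprD -mulrA ler_pM2l ?exprn_gt0//.
  rewrite ler_pdivlMr// !exprS.
  have : 0 <= ((1 - rho) ^+ 2 - s * D) * rho ^+ i.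
    by rewrite mulr_ge0 ?exprn_ge0 ?subr_ge0// (ltW rho0).
  have : 0 <= (1 - rho) * (s * D) * rho ^+ i.
    by rewrite mulr_ge0 ?exprn_ge0 ?mulr_ge0//; lra.
  move: (rho ^+ i) => r; nra.
rewrite exprS invfM.
have -> : rho ^+ (level_dist a x.2 + k.+1) =
  (1 + s)^-1 * (rho ^+ (level_dist a x.2 + k.+1) * (1 + s)).
  by rewrite mulrCA mulVf ?mulr1// gt_eqF.
have r0 : 0 <= (1 + s)^-1 by rewrite invr_ge0 ltW.
apply: le_trans (ler_wpM2l r0 (le_trans phi_ge step)) _.
by rewrite mulrDr lerD2r ler_piMl.
Qed.

Definition covers_level a q := [forall g : G, (g, a) \in q].

(** Union bound: either the level gets fewer than [k] visits, or some vertex is missed despite [k]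
    visits. *)
Lemma uncovered_bound (A rho s : R) k n x : 1 <= A ->
  (forall y n g i, killed_visits R e y n g i <= A) ->
  0 < rho <= 1 -> 0 <= s -> s <= (1 - rho) / 3 ->
  (forall g, s * cyl_valency R e g <= (1 - rho) ^+ 2) ->
  (forall g, 3 <= cyl_valency R e g) ->
  walk_exp e n x (fun q => (~~ covers_level x.2 q)%:R) <=
  1 - rho ^+ k + (1 + s) ^- n + 2 * #|G|%:R * (1 - (2 * A)^-1) ^+ k.
Proof.
move=> A1 kvA rho01 s0 s3 sval val3; set a := x.2.
pose T q : R := \sum_(g : G) (((g, a) \notin q) && (k <= level_visits a q)%N)%:R.
pose F q : R := 1 + (-1) * (k <= level_visits a q)%N%:R.
apply: le_trans (walk_exp_le (F2 := fun q => F q + T q) _ _ _) _ => [q _|].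
  rewrite /F /T mulN1r; case: (leqP k _) => _; last first.
    rewrite subr0 big1 ?addr0; last by move=> g _; rewrite andbF.
    by case: (covers_level a q).
  rewrite subrr add0r; case: (boolP (covers_level a q)) => [_|].
    by rewrite sumr_ge0.
  rewrite negb_forall => /existsP[g gq].
  by rewrite (bigD1 g)//= gq lerDl sumr_ge0.
rewrite walk_expD /F walk_expD walk_exp_cst walk_expZ /T walk_exp_sum.
have := local_time_lower a k n x rho01 s0 s3 sval val3.
rewrite level_distxx add0n => lt.
apply: lerD; first lra.
have -> : 2 * #|G|%:R * (1 - (2 * A)^-1) ^+ k =
    \sum_(g : G) (2 * (1 - (2 * A)^-1) ^+ k).
  by rewrite sumr_const -[RHS]mulr_natr; ring.
apply: ler_sum => g _; apply: le_trans (unhit_tail _ _ _ _ A1 (kvA g)) _.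
have A0 : 0 < A by lra.
rewrite ler_wpM2r ?exprn_ge0//.
  by rewrite subr_ge0 invf_le1//; lra.
by rewrite -[2]/(1 + 1) lerD2l ler_pdivrMr ?mul1r.
Qed.

End Cover.

(** * Iteration over consecutive blocks of the walk *)

Section Blocks.
Variables (R : realFieldType) (G : finType) (e : rel G).
Implicit Types (x : G * int) (q : seq (G * int)).

(** The level is left open because each block aims at the level of its own starting point. *)
Definition covers_some_level q := has (fun z => covers_level z.2 q) q.

Lemma covers_level_some (g : G) a q : covers_level a q -> covers_some_level q.
Proof. by move=> qa; apply/hasP; exists (g, a) => //; exact: (forallP qa). Qed.

Lemma covers_some_level_sub q1 q2 : {subset q1 <= q2} ->
  covers_some_level q1 -> covers_some_level q2.
Proof.
move=> q12 /hasP[z zq /forallP cov]; apply/hasP; exists z; first exact: q12.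
by apply/forallP => g; exact: q12.
Qed.

(** A path covering no level fails in every block, and each block fails with probability at most 1/2
    wherever it starts. *)
Lemma uncovered_blocks n k x :
  (forall z, walk_exp e n z (fun q => (~~ covers_level z.2 q)%:R) <= 2^-1 :> R) ->
  walk_exp e (k * n) x (fun q => (~~ covers_some_level q)%:R) <= 2^-1 ^+ k :> R.
Proof.
move=> half; elim: k => [|k IH].
  rewrite mul0n expr0 /=; exact: lexx.
rewrite mulSnr exprS; apply: (@le_trans _ _ (2^-1 * walk_exp e (k * n) x
    (fun q => (~~ covers_some_level q)%:R))); last by rewrite ler_pM2l// invr_gt0.
apply: (@walk_exp_markov _ _ _ _ _ _ _ _ _
  (fun q => (~~ covers_some_level q)%:R)) => //.
- move=> q1 q2; case: (boolP (covers_some_level q1)) => [c1|_].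
    rewrite (covers_some_level_sub _ c1) ?mul0r// => z zq.
    by rewrite mem_cat zq.
  case: (boolP (covers_some_level q2)) => [c2|_].
    rewrite (covers_some_level_sub _ c2) ?mulr0// => z zq.
    by rewrite mem_cat zq orbT.
  by rewrite mulr1; case: (~~ _).
- move=> z; apply: le_trans (half z); apply: walk_exp_le => q _.
  case: (boolP (covers_level z.2 q)) => [c|_]; last by case: (~~ _).
  by rewrite (covers_level_some z.1 c).
Qed.

End Blocks.

(** * Numerical estimates and choice of the block length *)

Section Constants.
Variable R : realType.

Lemma harmonic_le_ln m : (0 < m)%N ->
  \sum_(i < m) i.+1%:R^-1 <= 1 + ln m%:R :> R.
Proof.
elim: m => // -[_ _|m IH _]; first by rewrite big_ord1 ln1 invr1 addr0.
rewrite big_ord_recr /=; have m0 : 0 < m.+1%:R :> R by rewrite ltr0n.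
have M0 : 0 < m.+2%:R :> R by rewrite ltr0n.
have : ln (1 - m.+2%:R^-1) <= - m.+2%:R^-1 :> R.
  by apply: le_ln1Dx; rewrite ltrN2 invf_lt1// ltr1n.
have -> : 1 - m.+2%:R^-1 = m.+1%:R / m.+2%:R :> R.
  rewrite -[m.+2%:R]natr1; move: (m.+1%:R) m0 => u u0.
  by field; rewrite gt_eqF//; lra.
rewrite ln_div ?posrE//; move=> h.
apply: le_trans (lerD (IH isT) (lexx _)) _.
by move: (ln _) (ln _) (_^-1) h => a b c; lra.
Qed.

Lemma bernoulli_ineq (t : R) k : 0 <= t <= 1 -> 1 - k%:R * t <= (1 - t) ^+ k.
Proof.
move=> /andP[t0 t1]; elim: k => [|k IH]; first by rewrite mul0r subr0 expr0.
have := ler_wpM2l (_ : 0 <= 1 - t) IH; rewrite subr_ge0 exprS => /(_ t1).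
apply: le_trans; rewrite -natr1.
have : 0 <= k%:R * (t * t) by rewrite ?mulr_ge0.
by move: (k%:R) => u; lra.
Qed.

Lemma bernoulli_ineq_pos (t : R) k : 0 <= t -> 1 + k%:R * t <= (1 + t) ^+ k.
Proof.
move=> t0; elim: k => [|k IH]; first by rewrite mul0r addr0 expr0.
have := ler_wpM2l (_ : 0 <= 1 + t) IH; rewrite exprS => /(_ (addr_ge0 ler01 t0)).
apply: le_trans; rewrite -natr1.
have : 0 <= k%:R * (t * t) by rewrite ?mulr_ge0.
by move: (k%:R) => u; lra.
Qed.

(** Obtained from [n = 448 (d+2) k^2] and [k <= 9 A l = 144 (d+2) m l^2]. *)
Definition block_constant (d : nat) : R :=
  448 * 144 ^+ 2 * (d + 2)%:R ^+ 3.

(* Used with rho = 1 - 1 / (8 k) and s = (1 - rho) ^ 2 / (d + 2), for which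
   n = 448 (d + 2) k ^ 2 makes s n = 7. *)
Lemma half_uncovered (G : finType) (e : rel G) d :
  connected_simple_graph e -> (3 <= #|G|)%N -> 1 <= ln #|G|%:R :> R ->
  (max_degree e <= d)%N ->
  exists n, n%:R <= block_constant d * (#|G|%:R ^+ 2 * ln #|G|%:R ^+ 4) /\
  forall x, walk_exp e n x (fun q => (~~ covers_level x.2 q)%:R) <= 2^-1 :> R.
Proof.
move=> [syme irre conn] G3 l1 maxd; set m : R := #|G|%:R in l1 *.
set l := ln m in l1 *; have m3 : 3 <= m by rewrite ler_nat.
pose D : R := (d + 2)%:R; have D2 : 2 <= D by rewrite ler_nat leq_addl.
(* The harmonic sum is at most [1 + l], hence at most [2 * l], so [A] dominates [visits_bound]. *)
pose A := 16 * D * m * l.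
have A1 : 1 <= A.
  have Dm : 1 <= D * m by rewrite mulr_ege1//; lra.
  have : 1 <= D * m * l by rewrite mulr_ege1.
  by rewrite /A -!mulrA; lra.
have A0 : 0 < A by lra.
have kvA y n g i : killed_visits R e y n g i <= A.
  apply: le_trans (killed_visits_bound R y n g i syme conn maxd) _.
  rewrite /visits_bound -/m -/D /A.
  have -> : 16 * D * m * l = 8 * D * m * (2 * l) by ring.
  rewrite ler_pM2l; last by rewrite !mulr_gt0//; lra.
  by apply: le_trans (harmonic_le_ln _) _; [exact: leq_trans G3|]; rewrite -/m -/l; lra.
have Al1 : 1 <= A * l by rewrite mulr_ege1.
(* The lower bound gives [k / (2 * A) >= 4 * l], so each vertex is missed with probability at most
   [2 * m ^- 4]. *)
have [k k_ge k_le] : exists2 k, 8 * A * l <= k%:R & k%:R <= 9 * A * l.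
  exists (Num.truncn (8 * A * l)).+1; first by rewrite ltW// truncnS_gt.
  have : (Num.truncn (8 * A * l))%:R <= 8 * A * l by rewrite truncn_le; lra.
  by rewrite -natr1; lra.
have k1 : 1 <= k%:R :> R by lra.
have k0 : 0 < k%:R :> R by lra.
pose t : R := (8 * k%:R)^-1.
have t0 : 0 < t by rewrite invr_gt0; lra.
have t8 : t <= 8^-1 by rewrite lef_pV2 ?posrE; lra.
pose s := t ^+ 2 / D.
have s0 : 0 < s by rewrite divr_gt0 ?exprn_gt0//; lra.
have [n nE] : exists n, n%:R = 448 * D * k%:R ^+ 2 :> R.
  by exists (448 * (d + 2) * k ^ 2)%N; rewrite 2!natrM natrX.
exists n; split=> [|x].
  rewrite nE /block_constant -/D -/m -/l.
  have -> : 448 * 144 ^+ 2 * D ^+ 3 * (m ^+ 2 * l ^+ 4) =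
    448 * D * (9 * A * l) ^+ 2 by rewrite /A; ring.
  rewrite ler_pM2l; last lra.
  by rewrite ler_pXn2r// ?nnegrE; lra.
have val3 g : 3 <= cyl_valency R e g.
  rewrite ler_nat addn2 !ltnS; apply/card_gt0P.
  have [h gh] : exists h, h != g.
    have /card_gt1P[h1 [h2 [_ _ h12]]] : (1 < #|G|)%N by exact: leq_trans G3.
    have [eq1|] := eqVneq h1 g; last by exists h1.
    by exists h2; rewrite -eq1 eq_sym.
  have /connectP[[|h' p] /=] := conn g h; first by move=> _ hg; rewrite hg eqxx in gh.
  by move=> /andP[gh' _] _; exists h'.
have valD g : cyl_valency R e g <= D.
  rewrite ler_nat leq_add2r (leq_trans _ maxd)//.
  exact: (@leq_bigmax _ (fun h => #|[pred k | e h k]|) g).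
apply: le_trans (uncovered_bound (rho := 1 - t) (s := s) k n x A1 kvA _ _ _ _ val3) _.
- by apply/andP; split; lra.
- exact: ltW.
- rewrite subKr ler_pdivrMr; last lra.
  have : t * t <= 8^-1 * t by rewrite ler_pM2r.
  have : t * 2 <= t * D by rewrite ler_pM2l.
  by rewrite expr2; lra.
- move=> g; rewrite subKr /s -mulrA mulrC -[leRHS]mul1r ler_pM2r ?exprn_gt0//.
  by rewrite ler_pdivrMl ?mulr1//; lra.
have kt : k%:R * t = 8^-1 by rewrite /t invfM mulrCA mulfV ?mulr1// gt_eqF.
(* The three errors 1/8, 1/8 and 1/4 add up to 1/2. *)
have b1 : 1 - (1 - t) ^+ k <= 8^-1.
  have := @bernoulli_ineq t k; rewrite kt => H.
  have : 1 - 8^-1 <= (1 - t) ^+ k by apply: H; apply/andP; split; lra.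
  lra.
have b2 : (1 + s) ^- n <= 8^-1.
  rewrite lef_pV2 ?posrE ?exprn_gt0//; last lra.
  apply: le_trans (bernoulli_ineq_pos _ (ltW s0)).
  have -> : n%:R * s = 448 * (k%:R * t) ^+ 2.
    by rewrite nE /s; field; rewrite gt_eqF//; lra.
  by rewrite kt; lra.
have b3 : 2 * m * (1 - (2 * A)^-1) ^+ k <= 4^-1.
  have le_exp : (1 - (2 * A)^-1) ^+ k <= expR (- (4 * l)).
    apply: (@le_trans _ _ (expR (- (2 * A)^-1) ^+ k)).
      rewrite lerXn2r ?nnegrE ?expR_ge0 ?expR_ge1Dx//.
      by rewrite subr_ge0 invf_le1; lra.
    rewrite -expRM_natl ler_expR mulrN lerN2 ler_pdivlMr; last lra.
    lra.
  have -> : 4^-1 = 2 * m * (8^-1 / m) by field; rewrite gt_eqF//; lra.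
  rewrite ler_pM2l; last lra.
  apply: le_trans le_exp _.
  rewrite expRN -[4]/(4%:R) expRM_natl lnK ?posrE; last lra.
  rewrite -invfM lef_pV2 ?posrE ?exprn_gt0 ?mulr_gt0//; try lra.
  rewrite exprSr ler_pM2r; last lra.
  have : 3 * 3 <= m * m by rewrite ler_pM.
  have : 0 <= (m * m - 9) * (m - 3) by rewrite mulr_ge0//; nra.
  by rewrite !exprS expr0; nra.
by move: b1 b2 b3; rewrite -/m; lra.
Qed.

End Constants.

(** * Covered levels disconnect the cylinder *)

Section Disconnect.
Variables (G : finType) (e : rel G).
Implicit Types (S : set (G * int)) (y z : G * int).

Lemma joined_off_refl S y : ~ S y -> joined_off e S y y.
Proof. by move=> Sy; exists [::]; split => // v; rewrite inE => /eqP ->. Qed.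

Lemma joined_off_trans S y1 y2 y3 : joined_off e S y1 y2 ->
  joined_off e S y2 y3 -> joined_off e S y1 y3.
Proof.
move=> [p1 [p1path last1 off1]] [p2 [p2path last2 off2]]; exists (p1 ++ p2); split.
- by rewrite cat_path p1path last1.
- by rewrite last_cat last1.
- move=> v; rewrite -cat_cons mem_cat => /orP[|vp2]; first exact: off1.
  by apply: off2; rewrite inE vp2 orbT.
Qed.

Lemma joined_off_vertical S g u (c : int) n : absz c = 1%N ->
  (forall i : nat, ~ S (g, u + c * i%:Z)) ->
  joined_off e S (g, u) (g, u + c * n%:Z).
Proof.
move=> c1 off; elim: n => [|n IH].
  rewrite mulr0 addr0; apply: joined_off_refl.
  by have := off 0%N; rewrite mulr0 addr0.
apply: joined_off_trans IH _; exists [:: (g, u + c * n.+1%:Z)]; split => //=.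
  rewrite andbT /cyl_adj /= eqxx /=; apply/orP; left.
  rewrite (_ : _ - _ = - c); first by rewrite normrN -abszE c1.
  by rewrite -addn1 PoszD mulrDr mulr1; ring.
by move=> v; rewrite !inE => /orP[] /eqP ->; exact: off.
Qed.

Lemma joined_off_horizontal S u g h : connect e g h ->
  (forall k, ~ S (k, u)) -> joined_off e S (g, u) (h, u).
Proof.
move=> /connectP[p ep ->] off; exists [seq (k, u) | k <- p]; split.
- rewrite (map_path (e' := e) (b := pred0)) //; last by rewrite has_pred0.
  by move=> k k' _; rewrite /cyl_adj /= eqxx subrr normr0 andbF.
- by rewrite (last_map (fun k => (k, u))).
- by move=> v; rewrite -(map_cons (fun k => (k, u))) => /mapP[k _ ->]; exact: off.
Qed.

(** Heights change by at most one per step, so a path cannot jump over the blocked level. *)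
Lemma joined_off_same_side S a y z : (forall g, S (g, a)) ->
  joined_off e S y z -> (a < y.2) -> (a < z.2).
Proof.
move=> Sa [p [pp <- off]]; elim: p y pp off => //= -[h v] p IH [g u] /=.
move=> /andP[uv pp] off au; apply: (IH _ pp).
  by move=> w wp; apply: off; rewrite inE wp orbT.
move: uv; rewrite /cyl_adj /= => /orP[/andP[_ uv]|/andP[/eqP <- _]//].
have : v != a.
  apply/eqP => va; apply: (off (h, v)); first by rewrite !inE eqxx orbT.
  by rewrite va.
by move: uv au; rewrite /=; lia.
Qed.

(** Beyond height [M0] nothing is blocked, so each end is connected through the column of [g0] and a
    horizontal path; level [a] separates the two ends. *)
Lemma level_disconnects S (g0 : G) a (M0 : int) :
  (forall g h, connect e g h) -> (forall g, S (g, a)) ->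
  (forall z, S z -> `|z.2| < M0) -> disconnects e S.
Proof.
move=> conn Sa SM; exists M0 => M M0M.
have aM := SM _ (Sa g0); rewrite /= in aM.
have off_hi g u : M <= u -> ~ S (g, u) by move=> Mu /SM /=; lia.
have off_lo g u : u <= - M -> ~ S (g, u) by move=> Mu /SM /=; lia.
exists [set z | joined_off e S (g0, M) z], [set z | joined_off e S (g0, - M) z].
split.
- by exists (g0, M) => //; exact: off_hi.
- by exists (g0, - M) => //; exact: off_lo.
- move=> C12; have : joined_off e S (g0, M) (g0, - M).
    rewrite -/([set z | joined_off e S (g0, M) z] (g0, - M)) C12 /=.
    by apply: joined_off_refl; exact: off_lo.
  by move/(joined_off_same_side Sa) => /=; lia.
- move=> [g u] /= Mu; apply: (@joined_off_trans _ _ (g0, u)).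
    rewrite (_ : u = M + 1 * (absz (u - M)%R)%:Z); last by lia.
    by apply: joined_off_vertical => // i; apply: off_hi; lia.
  by apply: joined_off_horizontal => // k; exact: off_hi.
- move=> [g u] /= Mu; apply: (@joined_off_trans _ _ (g0, u)).
    rewrite (_ : u = - M + (-1) * (absz (u + M)%R)%:Z); last by lia.
    by apply: joined_off_vertical => // i; apply: off_lo; lia.
  by apply: joined_off_horizontal => // k; exact: off_lo.
Qed.

Lemma disconnection_time_le (R : realType) (X : nat -> G * int) n :
  (forall g h, connect e g h) ->
  covers_some_level (mkseq X n) -> (disconnection_time e R X <= n%:R%:E)%E.
Proof.
move=> conn /hasP[[g0 a] _ /forallP /= cov].
have n0 : (0 < n)%N by case: n cov => // cov; have := cov g0.
(* The last position in [mkseq X n] is that of time [n.-1]. *)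
apply: (@le_trans _ _ n.-1%:R%:E); last by rewrite lee_fin ler_nat leq_pred.
apply: ereal_inf_lbound; exists n.-1 => //.
pose M0 : int := (\max_(i < n) absz (X i).2).+1.
apply: (@level_disconnects _ g0 a M0) => //.
  move=> g; have /mapP[k] := cov g; rewrite mem_iota /= add0n => kn Xk.
  by exists k => //=; rewrite -ltnS prednK.
move=> _ [k /= kn <-].
have kn' : (k < n)%N by rewrite -(prednK n0) ltnS.
have := @leq_bigmax _ (fun i : 'I_n => absz (X i).2) (Ordinal kn').
by rewrite /M0 /=; lia.
Qed.

End Disconnect.

(** * From path expectations to the law of the walk *)

Section Law.
Variables (R : realType) (G : finType) (e : rel G).
Hypothesis irre : irreflexive e.
Variables (d : measure_display) (Omega : measurableType d).
Variables (P : probability Omega R) (X : nat -> Omega -> G * int) (x : G * int).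
Hypothesis walkX : simple_random_walk_from e P X x.
Implicit Types (y z : G * int) (q : seq (G * int)).

Definition cyl_nbrs y : seq (G * int) :=
  [:: (y.1, y.2 + 1), (y.1, y.2 - 1) & [seq (h, y.2) | h <- enum (e y.1)]].

Lemma mem_cyl_nbrs y z : cyl_adj e y z -> z \in cyl_nbrs y.
Proof.
case: y z => g u [h v]; rewrite /cyl_adj /cyl_nbrs !inE /= !xpair_eqE.
case/orP => /andP[/eqP <-].
  rewrite !eqxx /= => uv.
  have [->|->] : v = u + 1 \/ v = u - 1 by lia.
    by rewrite eqxx.
  by rewrite eqxx orbT.
move=> gh; apply/or3P/Or33/mapP.
by exists h; rewrite ?mem_enum.
Qed.

Lemma sum_step_prob (f : G * int -> R) y :
  \sum_(z <- cyl_nbrs y) step_prob e R y z * f z = walk_avg e f y.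
Proof.
have stepE z : cyl_adj e y z -> step_prob e R y z = (cyl_valency R e y.1)^-1.
  by rewrite /step_prob => ->; rewrite cyl_degE.
have up : cyl_adj e y (y.1, y.2 + 1) by rewrite /cyl_adj /= eqxx; lia.
have down : cyl_adj e y (y.1, y.2 - 1) by rewrite /cyl_adj /= eqxx; lia.
rewrite /cyl_nbrs !big_cons big_map big_enum /= (stepE _ up) (stepE _ down).
have -> : \sum_(h in e y.1) step_prob e R y (h, y.2) * f (h, y.2) =
    (cyl_valency R e y.1)^-1 * \sum_(h | e y.1 h) f (h, y.2).
  rewrite mulr_sumr; apply: eq_bigr => h gh; rewrite stepE//.
  by rewrite /cyl_adj /= eqxx (_ : e y.1 h) ?orbT.
by rewrite /walk_avg -!mulrDr addrA addrC mulrC.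
Qed.

Definition path_event q : set Omega := [set w | mkseq (X^~ w) (size q) = q].

(** There are countably many finite paths, so any such event is a countable union of events fixing
    the whole path. *)
Lemma measurable_path (Q : seq (G * int) -> Prop) n :
  measurable [set w | Q (mkseq (X^~ w) n)].
Proof.
have meq q : measurable [set w | mkseq (X^~ w) n = q].
  elim: n q => [|n IH] q.
    have [->|q0] := eqVneq q [::].
      by rewrite (_ : [set _ | _] = setT); [exact: measurableT|apply/seteqP; split].
    rewrite (_ : [set _ | _] = set0); first exact: measurable0.
    by apply/seteqP; split => // w /= eqq; rewrite -eqq in q0.
  case/lastP: q => [|q z].
    rewrite (_ : [set _ | _] = set0); first exact: measurable0.
    by apply/seteqP; split => // w /=; rewrite mkseqS; case: (mkseq _ _).
  rewrite (_ : [set _ | _] = [set w | mkseq (X^~ w) n = q] `&` [set w | X n w = z]).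
    by apply: measurableI => //; exact: walkX.1.
  apply/seteqP; split => w /=; rewrite mkseqS.
    by move/eqP; rewrite eqseq_rcons => /andP[/eqP -> /eqP ->].
  by move=> [-> ->].
pose F k : set Omega := if @unpickle (seq (G * int)) k is Some q then
  (if pselect (Q q) then [set w | mkseq (X^~ w) n = q] else set0) else set0.
rewrite (_ : [set _ | _] = \bigcup_k F k).
  apply: bigcup_measurable => k _; rewrite /F; case: unpickle => // q.
  by case: pselect => _ /=; [exact: meq|exact: measurable0].
apply/seteqP; split => w /=.
  move=> Qw; exists (pickle (mkseq (X^~ w) n)) => //.
  by rewrite /F pickleK; case: pselect.
by move=> [k _]; rewrite /F; case: unpickle => // q; case: pselect => //= Qq ->.
Qed.

Lemma path_event_law q y z : P (path_event (rcons (rcons q y) z)) =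
  (P (path_event (rcons q y)) * (step_prob e R y z)%:E)%E.
Proof.
have pathE q' : (0 < size q')%N -> path_event q' =
    [set w | forall k, (k <= (size q').-1)%N -> X k w = nth x q' k].
  move=> q'0; apply/seteqP; split => w /=.
    move=> eqq k kq; rewrite -[in RHS]eqq nth_mkseq//.
    by rewrite -(prednK q'0) ltnS.
  move=> eqX; apply: (@eq_from_nth _ x); rewrite size_mkseq// => k kq.
  by rewrite nth_mkseq// eqX// -ltnS prednK.
rewrite !pathE ?size_rcons// !walkX.2 /= big_ord_recr /= -EFinM mulrA.
congr ((_ * _)%:E).
  congr (_ * _); first by rewrite !nth_rcons size_rcons /=; case: (size q).
  apply: eq_bigr => i _; have iq := ltn_ord i.
  by rewrite ![nth _ (rcons (rcons _ _) _) _]nth_rcons size_rcons !ltnS (ltnW iq) iq.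
by rewrite !nth_rcons !size_rcons ltnSn !ltnn !eqxx.
Qed.

(** Conditioning on the past [q] and the present [y]. The list averaged by [walk_exp] begins with
    [y], hence the total length [size q + n]. *)
Lemma path_event_le (B : pred (seq (G * int))) n q y :
  (P (path_event (rcons q y) `&` [set w | B (mkseq (X^~ w) (size q + n))]) <=
  P (path_event (rcons q y)) * (walk_exp e n y (fun r => (B (q ++ r))%:R))%:E)%E.
Proof.
elim: n q y => [|n IH] q y.
  rewrite addn0 /= cats0; case: (boolP (B q)) => Bq.
    rewrite mule1 le_measure ?inE//.
      apply: measurableI; first exact: (@measurable_path (fun r => r = _)).
      exact: (@measurable_path B).
    exact: (@measurable_path (fun r => r = _)).
  rewrite mule0 (_ : _ `&` _ = set0) ?measure0//.
  apply/seteqP; split => // w [] /=; rewrite /path_event /= size_rcons mkseqS.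
  by move/eqP; rewrite eqseq_rcons => /andP[/eqP -> _]; rewrite (negbTE Bq).
set E := _ `&` _.
have mpe r : measurable (path_event r) by exact: (@measurable_path (fun r' => r' = r)).
pose E' z := path_event (rcons (rcons q y) z) `&`
  [set w | B (mkseq (X^~ w) (size (rcons q y) + n))].
have mE' z : measurable (E' z).
  by apply: measurableI => //; exact: (@measurable_path B).
(* The next step goes to one of finitely many neighbors outside the null set [N] of non-adjacent
   jumps. *)
pose N := \bigcup_k (if @unpickle (G * int)%type k is Some z then
  if cyl_adj e y z then set0 else path_event (rcons (rcons q y) z) else set0).
have mN : measurable N.
  apply: bigcup_measurable => k _; case: unpickle => // z.
  by case: ifP.
have N0 : P N = 0.
  apply/negligibleP => //; apply: negligible_bigcup => k.
  case: unpickle => [z|]; last exact: negligible_set0.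
  case: ifP => [_|yz]; first exact: negligible_set0.
  apply/negligibleP => //.
  by move: (path_event_law q y z); rewrite /step_prob yz mule0.
have mU (l : seq (G * int)) : measurable (\big[setU/set0]_(z <- l) E' z).
  by apply: bigsetU_measurable => z _.
have EU : E `<=` \big[setU/set0]_(z <- cyl_nbrs y) E' z `|` N.
  move=> w [qw Bw]; pose z := X (size q).+1 w.
  have qzw : path_event (rcons (rcons q y) z) w.
    by move: qw; rewrite /path_event /= size_rcons [in X in _ -> X]size_rcons
      [in X in _ -> X]mkseqS size_rcons => ->.
  case: (boolP (cyl_adj e y z)) => [yz|yz].
    left; rewrite -bigcup_seq; exists z; first exact: mem_cyl_nbrs.
    by split => //=; move: Bw => /=; rewrite size_rcons addSnnS.
  by right; exists (pickle z) => //; rewrite pickleK (negbTE yz).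
have Ule (l : seq (G * int)) :
    (P (\big[setU/set0]_(z <- l) E' z) <= \sum_(z <- l) P (E' z))%E.
  elim: l => [|z l IHl]; first by rewrite !big_nil measure0.
  rewrite !big_cons; apply: le_trans (measureU2 _ _ _) _ => //.
  by rewrite leeD2l.
have mE : measurable E.
  by apply: measurableI => //; exact: (@measurable_path B).
apply: (@le_trans _ _ (P (\big[setU/set0]_(z <- cyl_nbrs y) E' z `|` N))).
  by rewrite le_measure ?inE//; apply: measurableU.
have UN_le : (P (\big[setU/set0]_(z <- cyl_nbrs y) E' z `|` N) <=
    P (\big[setU/set0]_(z <- cyl_nbrs y) E' z) + P N)%E by exact: measureU2.
apply: le_trans UN_le _; rewrite N0 adde0.
apply: le_trans (Ule _) _ => {Ule}.
have fin_path : P (path_event (rcons q y)) \is a fin_num by rewrite fin_num_measure.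
rewrite -(fineK fin_path) -EFinM /= -sum_step_prob mulr_sumr -sumEFin.
apply: lee_sum => z _; apply: le_trans (IH _ _) _.
rewrite path_event_law -[in leLHS](fineK fin_path) -!EFinM lee_fin -mulrA.
rewrite le_eqVlt; apply/orP; left; apply/eqP; congr (_ * (_ * walk_exp _ _ _ _)).
by apply/funext => r; rewrite cat_rcons.
Qed.

Lemma prob_path_le (B : pred (seq (G * int))) n :
  (P [set w | B (mkseq (X^~ w) n)] <=
   (walk_exp e n x (fun q => (B q)%:R))%:E)%E.
Proof.
have mpe r : measurable (path_event r) by exact: (@measurable_path (fun r' => r' = r)).
have P1 : P (path_event [:: x]) = 1%:E.
  have := walkX.2 0%N (fun=> x); rewrite big_ord0 mulr1 eqxx => <-.
  congr (P _); apply/seteqP; split => w /=.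
    by case=> X0 [|k].
  by move=> X0; rewrite /path_event /mkseq /= X0.
have mB : measurable [set w | B (mkseq (X^~ w) n)] by exact: (@measurable_path B).
have P0 : P (~` path_event [:: x]) = 0 by rewrite probability_setC// P1 subee.
have := path_event_le B n [::] x; rewrite [rcons _ _]/= P1 mul1e add0n; apply: le_trans.
rewrite -[leRHS]adde0 -P0; apply: le_trans (measureU2 _ _ _); last 2 first.
- exact: measurableI.
- exact: measurableC.
rewrite le_measure ?inE//; first by apply: measurableU; [exact: measurableI|exact: measurableC].
by move=> w Bw; case: (pselect (path_event [:: x] w)) => H; [left|right].
Qed.

End Law.

(** * Expected disconnection time and the limit *)

(** The integral is a supremum over the simple functions below the integrand. This serves for
    [disconnection_time], whose measurability is not established. *)
Lemma ge0_le_integral_nomeas (R : realType) (d : measure_display)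
    (T : measurableType d) (mu : {measure set T -> \bar R}) (f g : T -> \bar R) :
  (forall w, 0 <= f w)%E -> (forall w, f w <= g w)%E ->
  (\int[mu]_w f w <= \int[mu]_w g w)%E.
Proof.
move=> f0 fg; have g0 w : (0 <= g w)%E by exact: le_trans (f0 w) (fg w).
rewrite !ge0_integralTE//; apply: ereal_sup_le => _ [h hf <-].
by exists h => // w; exact: le_trans (hf w) (fg w).
Qed.

(** If block count [j] is the first to cover a level, the time is at most [j * n], that is [n] for
    each earlier failure; the failure probabilities are at most [2^-k] and sum to at most 2. *)
Lemma expected_disconnection_time_le (R : realType) (G : finType) (e : rel G)
    (d : measure_display) (Omega : measurableType d) (P : probability Omega R)
    (X : nat -> Omega -> G * int) x n :
  connected_simple_graph e -> simple_random_walk_from e P X x ->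
  (forall z, walk_exp e n z (fun q => (~~ covers_level z.2 q)%:R) <= 2^-1 :> R) ->
  (\int[P]_w disconnection_time e R (fun k => X k w) <= (n%:R * 2)%:E)%E.
Proof.
move=> [syme irre conn] walkX half.
pose U k : set Omega := [set w | ~~ covers_some_level (mkseq (X^~ w) (k * n))].
have mU k : measurable (U k).
  exact: (measurable_path walkX (fun q => ~~ covers_some_level q)).
have PU k : (P (U k) <= (2^-1 ^+ k)%:E)%E.
  apply: le_trans (prob_path_le irre walkX (fun q => ~~ covers_some_level q) _) _.
  by rewrite lee_fin uncovered_blocks.
have n0 : (0 < n)%N.
  rewrite lt0n; apply/eqP => n0; have := half x; rewrite n0 /=.
  have -> : covers_level x.2 ([::] : seq (G * int)) = false.
    by apply/negbTE; rewrite negb_forall; apply/existsP; exists x.1.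
  by rewrite /=; lra.
pose f k w : \bar R := (n%:R%:E * (\1_(U k) w)%:E)%E.
have f0 k w : (0 <= f k w)%E by rewrite mule_ge0// lee_fin.
have mf k : measurable_fun setT (f k).
  apply: measurable_funeM; apply/measurable_EFinP; exact: measurable_indic.
have Tf w : (disconnection_time e R (fun k => X k w) <= \sum_(0 <= k <oo) f k w)%E.
  have part j : (forall k, (k < j)%N -> U k w) ->
      ((j * n)%:R%:E <= \sum_(0 <= k <oo) f k w)%E.
    move=> Uw; apply: le_trans (nneseries_lim_ge j _); last by move=> *; exact: f0.
    rewrite big_mkord (eq_bigr (fun=> n%:R%:E)) => [|k _].
      by rewrite sumEFin sumr_const card_ord mulnC natrM mulr_natr.
    by rewrite /f indicE mem_set ?mule1//; exact: Uw.
  have [[j ncov jmin]|allU] := pselect (exists2 j, ~ U j w & forall k, (k < j)%N -> U k w).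
    apply: le_trans (part j jmin); apply: disconnection_time_le => //.
    by move/negP: ncov; rewrite negbK.
  have Uw k : U k w.
    elim/ltn_ind: k => k IH; apply: contrapT => nU.
    by apply: allU; exists k.
  suff -> : (\sum_(0 <= k <oo) f k w = +oo)%E by exact: leey.
  apply/eqyP => A A0; apply: le_trans (part (Num.truncn A).+1 (fun k _ => Uw k)).
  rewrite lee_fin; apply: (@le_trans _ _ (Num.truncn A).+1%:R).
    by rewrite ltW// truncnS_gt.
  by rewrite ler_nat leq_pmulr.
have T0 w : (0 <= disconnection_time e R (fun k => X k w))%E.
  by apply/ereal_infP => _ [k _ <-]; rewrite lee_fin.
apply: le_trans (ge0_le_integral_nomeas P T0 Tf) _.
rewrite integral_nneseries//.
have int_f k : (\int[P]_w f k w = n%:R%:E * P (U k))%E.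
  rewrite ge0_integralZl//.
  - by rewrite integral_indic// setIT.
  - by apply/measurable_EFinP; exact: measurable_indic.
apply: lime_le.
  by apply: is_cvg_nneseries => k _ _; apply: integral_ge0 => w _; exact: f0.
near=> m; rewrite big_mkord.
apply: (@le_trans _ _ (\sum_(i < m) (n%:R * 2^-1 ^+ i)%:E)%E).
  by apply: lee_sum => k _; rewrite int_f EFinM lee_wpmul2l// lee_fin.
rewrite sumEFin lee_fin -mulr_sumr ler_wpM2l//.
have <- : series (geometric 1 2^-1) m = \sum_(i < m) 2^-1 ^+ i :> R.
  by rewrite /series /= big_mkord; apply: eq_bigr => i _; exact: mul1r.
apply: le_trans (geometric_le_lim _ _ _ _) _ => //.
  by rewrite ger0_norm//; lra.
by rewrite (_ : 1 - 2^-1 = 2^-1) ?div1r ?invrK//; lra.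
Unshelve. all: by end_near.
Qed.

Theorem mainTheorem2 (R : realType) (d0 : nat) (hd0 : (2 <= d0)%N)
  (eps : R) (heps : 0 < eps) (delta : R) (hdelta : 0 < delta) :
  exists N : nat, forall (G : finType) (e : rel G),
    connected_simple_graph e -> (2 <= #|G|)%N -> (N <= #|G|)%N ->
    (max_degree e <= d0)%N ->
    forall (d : measure_display) (Omega : measurableType d)
      (P : G * int -> probability Omega R) (X : nat -> Omega -> G * int),
      (forall x, simple_random_walk_from e (P x) X x) ->
      (`| ereal_sup [set
            (\int[P x]_w disconnection_time e R (fun n => X n w))
              / (#|G|%:R ^+ 2 * ln #|G|%:R `^ (4 + eps))%:E
          | x in [set: G * int]] | < delta%:E)%E.
Proof.
(* The ratio is at most [2 * block_constant R d0 / ln m ^ eps], which is [delta / 2] when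
   [ln m ^ eps] equals [C]. *)
pose C : R := 4 * block_constant R d0 / delta.
have C0 : 0 < C.
  rewrite divr_gt0// mulr_gt0//.
  by rewrite !mulr_gt0 ?exprn_gt0 ?ltr0n ?addn2.
(* The summand 1 ensures [1 <= ln m], required by [half_uncovered]. *)
pose b : R := C `^ eps^-1 + 1.
have b1 : 1 <= b by rewrite lerDr powR_ge0.
exists ((Num.truncn (expR b)).+1 + 3)%N => G e graphG G2 NG maxd d Omega P X walkX.
have G3 : (3 <= #|G|)%N by apply: leq_trans NG; rewrite leq_addl.
have G0 : (0 < #|G|)%N by exact: leq_trans G3.
set m : R := #|G|%:R; have m0 : 0 < m by rewrite ltr0n.
have lb : b <= ln m.
  rewrite -ler_expR lnK ?posrE//; apply: le_trans (ltW (truncnS_gt _)) _.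
  by rewrite ler_nat; apply: leq_trans NG; rewrite leq_addr.
have l1 : 1 <= ln m by exact: le_trans lb.
have l0 : 0 < ln m by lra.
have Cl : C <= ln m `^ eps.
  have -> : C = (C `^ eps^-1) `^ eps.
    by rewrite -powRrM mulVf ?gt_eqF// powRr1// ltW.
  apply: ge0_ler_powR; rewrite ?nnegrE ?powR_ge0 ?(ltW l0) ?(ltW heps)//.
  by apply: le_trans lb; rewrite lerDl.
have [n [n_le half]] := half_uncovered graphG G3 l1 maxd.
have den0 : 0 < m ^+ 2 * ln m `^ (4 + eps).
  by rewrite mulr_gt0 ?exprn_gt0 ?powR_gt0.
(* The bound [delta / 2] keeps the inequality strict after the supremum. *)
have ratio_le x : ((\int[P x]_w disconnection_time e R (fun n => X n w))
    / (m ^+ 2 * ln m `^ (4 + eps))%:E <= (delta / 2)%:E)%E.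
  rewrite inver gt_eqF// lee_pdivrMr//.
  apply: le_trans (expected_disconnection_time_le graphG (walkX x) half) _.
  rewrite -EFinM lee_fin powRD; last by apply/implyP => _; rewrite gt_eqF.
  rewrite (powR_mulrn 4 (ltW l0)).
  have : block_constant R d0 * (m ^+ 2 * ln m ^+ 4) * 2 <=
      delta / 2 * (m ^+ 2 * (ln m ^+ 4 * ln m `^ eps)).
    have -> : block_constant R d0 * (m ^+ 2 * ln m ^+ 4) * 2 =
        delta / 2 * (m ^+ 2 * (ln m ^+ 4 * C)).
      by rewrite /C; field; rewrite gt_eqF.
    by rewrite !ler_pM2l ?divr_gt0 ?exprn_gt0.
  by apply: le_trans; rewrite ler_pM2r.
have ratio_ge0 x : (0 <= (\int[P x]_w disconnection_time e R (fun n => X n w))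
    / (m ^+ 2 * ln m `^ (4 + eps))%:E)%E.
  rewrite inver gt_eqF// lee_pdivlMr// mul0e; apply: integral_ge0 => w _.
  by apply/ereal_infP => _ [k _ <-]; rewrite lee_fin.
have /card_gt0P[g0 _] := G0.
rewrite gee0_abs.
  apply: (@le_lt_trans _ _ (delta / 2)%:E); last by rewrite lte_fin; lra.
  by apply: ge_ereal_sup => _ [x _ <-].
apply: le_trans (ratio_ge0 (g0, 0)) _.
by apply: ereal_sup_ubound; exists (g0, 0).
Qed.
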